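(* Every vertex of $\mathcal W_\theta$ has at most two fractional components (components $w_i$ with $0<w_i<1/N$). More generally, fix any $w\in\mathcal W_\theta$ with $|J(w)|\le2$, and let $\mathcal K_\theta(w)\subseteq\{0,1\}^N$ be the binary set of $\mathfrak z\in\{0,1\}^N$ defined by $\omega^\top\mathfrak z\le b(w)$ when $B(w)=0$ and by $\omega^\top\mathfrak z<b(w)$ when $B(w)>0$. Then $\operatorname{conv}(\mathcal K_\theta(w))$ is the projection onto $\mathfrak z$ of the system $$\begin{aligned}&\sum_{a\in\mathcal T_\theta(w)}\psi_a=1,\\&\psi_a\ge0&&\forall a\in\mathcal T_\theta(w),\\&\mathfrak z_j=\sum_{a\in\mathcal T_\theta(w)}a_j\psi_a&&\forall j\in J(w),\\&\mathfrak z_i=\sum_{a\in\mathcal T_\theta(w)}y_i^a&&\forall i\in F(w),\\&\sum_{i\in F(w)}y_i^a\le k_a\psi_a&&\forall a\in\mathcal T_\theta(w),\\&0\le y_i^a\le\psi_a&&\forall i\in F(w),\ a\in\mathcal T_\theta(w),\\&0\le\mathfrak z_i\le1&&\forall i\in Z(w).\end{aligned}$$ The formulation uses at most four pattern variables $\psi_a$ and $O(N)$ continuous variables and constraints. Equivalently, eliminating $y$ (i.e. replacing the three families of constraints involving the variables $y_i^a$) yields, in addition to nonnegativity of $\mathfrak z$, $$\sum_{i\in S}\mathfrak z_i\le\sum_{a\in\mathcal T_\theta(w)}\psi_a\min\{|S|,k_a\}\qquad\forall S\subseteq F(w),$$ and these inequalities can be separated after sorting the components $\mathfrak z_i$, $i\in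 F(w)$.
   Context: $[N]=\{1,\dots,N\}$; $\mathbf 1$ all-ones. Two distinct symbols: $\varepsilon\in(0,1]$ (lower bound on the conditioning probability) and $\epsilon\in(0,1)$ (risk limit). Let $(\mathcal X,d_{\mathcal X})$, $(\mathcal Y,d_{\mathcal Y})$ be Polish metric spaces, $(\hat x_i,\hat y_i)\in\mathcal X\times\mathcal Y$, $i\in[N]$, samples with empirical distribution $\widehat{\mathbb P}_N$, $\mathcal N\subseteq\mathcal X$ a Borel neighborhood of a target context $x_0$ such that all distances from $\hat x_i$ to $\mathcal N$ and $\mathcal N^c$ are finite, and $W$ the type-1 Wasserstein distance with ground metric $d_{\mathcal X}+d_{\mathcal Y}$. Set $\kappa_i^{\rm in}=\inf_{x\in\mathcal N}d_{\mathcal X}(\hat x_i,x)$, $\kappa_i^{\rm out}=\inf_{x\in\mathcal N^c}d_{\mathcal X}(\hat x_i,x)$, $\bar\kappa_i=\kappa_i^{\rm in}-\kappa_i^{\rm out}$, $K_0=\frac1N\sum_i\kappa_i^{\rm out}$. The radius satisfies the standing condition $\theta>\theta_{\min}:=\inf\{W(\mathbb P,\widehat{\mathbb P}_N):\mathbb P_X(\mathcal N)\ge\varepsilon\}$ ($\mathbb P_X$ is the $\mathcal X$-marginal). $$\mathcal W_\theta=\{w\in\mathbb R^N:0\le w_i\le\tfrac1N,\ \mathbf 1^\top w\ge\varepsilon,\ K_0+\bar\kappa^\top w\le\theta\},\qquad B(w)=\theta-K_0-\bar\kappa^\top w.$$ For $w\in\mathcal W_\theta$ put $\omega=Nw$,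 $F(w)=\{i:\omega_i=1\}$, $J(w)=\{i:0<\omega_i<1\}$, $Z(w)=\{i:\omega_i=0\}$, $b(w)=\epsilon\sum_{i\in[N]}\omega_i$, and for $a\in\{0,1\}^{J(w)}$, $\alpha(a)=\sum_{j\in J(w)}\omega_ja_j$. The admissible patterns are $\mathcal T_\theta(w)=\{a\in\{0,1\}^{J(w)}:\alpha(a)\le b(w)\}$ if $B(w)=0$ and $\mathcal T_\theta(w)=\{a\in\{0,1\}^{J(w)}:\alpha(a)<b(w)\}$ if $B(w)>0$. The cardinality bounds are $k_a=\min\{|F(w)|,\widehat k_a\}$ with $\widehat k_a=\lfloor b(w)-\alpha(a)\rfloor$ if $B(w)=0$ and $\widehat k_a=\lceil b(w)-\alpha(a)\rceil-1$ if $B(w)>0$. *)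

(* Defs.v *)
From HB Require Import structures.
From mathcomp Require Import all_boot all_order all_algebra.
From mathcomp Require Import all_classical all_reals all_analysis.

Set Implicit Arguments.
Unset Strict Implicit.
Unset Printing Implicit Defensive.

Import Order.TTheory GRing.Theory Num.Theory.

Local Open Scope classical_set_scope.
Local Open Scope ring_scope.

HB.mixin Record isSeparable T & Topological T := {
  separable_space : exists2 D : set T, countable D & dense D }.

(* Completeness brings in the library's [Pointed] structure, so these spaces
   are nonempty. *)
#[short(type="polishMetricType")]
HB.structure Definition PolishMetric (R : numDomainType) :=
  {T of Metric R T & Complete T & isSeparable T}.

Notation borel X := (g_sigma_algebraType (@open X)).

Section Wasserstein.
Context (R : realType) d (T : measurableType d).

Definition coupling (mu nu : set T -> \bar R) : set (probability (T * T)%type R) :=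
  [set pi | forall A, measurable A ->
     pi (A `*` setT) = mu A /\ pi (setT `*` A) = nu A].

Definition wasserstein1 (c : T -> T -> R) (mu nu : set T -> \bar R) : \bar R :=
  ereal_inf [set (\int[pi]_u (c u.1 u.2)%:E)%E | pi in coupling mu nu].

End Wasserstein.

Section Data.
Context (R : realType) (X Y : polishMetricType R) (N : nat).

(* For separable spaces the product of the Borel sigma-algebras is the Borel
   sigma-algebra of the product. *)
Definition ground_cost (u v : borel X * borel Y) : R :=
  mdist (u.1 : X) (v.1 : X) + mdist (u.2 : Y) (v.2 : Y).

Definition empirical (xhat : 'I_N -> X) (yhat : 'I_N -> Y)
    (A : set (borel X * borel Y)) : \bar R :=
  ((N%:R^-1)%:E * \sum_(i < N) \d_((xhat i, yhat i) : borel X * borel Y) A)%E.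

Definition theta_min (xhat : 'I_N -> X) (yhat : 'I_N -> Y) (U : set X)
    (eps : R) : \bar R :=
  ereal_inf [set wasserstein1 ground_cost P (empirical xhat yhat)
    | P in [set P : probability (borel X * borel Y)%type R
            | (eps%:E <= pushforward P fst (U : set (borel X)))%E]].

Definition dist_to (x : X) (A : set X) : \bar R :=
  ereal_inf [set (mdist x u)%:E | u in A].

End Data.

Section Convexity.
Context (R : realType) (V : lmodType R).

Definition vertex (P : set V) (v : V) : Prop :=
  P v /\ forall u u' (t : R), P u -> P u' -> 0 < t < 1 ->
    v = t *: u + (1 - t) *: u' -> u = u'.

Definition conv_hull (A : set V) : set V := smallest (@convex_set R V) A.

End Convexity.

Section LinearSystems.
Context (R : realType) (V : finType).

(* An affine expression is its vector of coefficients, the coefficient of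
   [None] being the constant term. *)
Definition affine := {ffun option V -> R^o}.

Definition avar (v : V) : affine := [ffun u => (u == Some v)%:R].
Definition acst (c : R) : affine := [ffun u => if u is Some _ then 0 else c].

Definition aval (x : V -> R) (e : affine) : R :=
  e None + \sum_v e (Some v) * x v.

Inductive constraint := LeC of affine & affine | EqC of affine & affine.

Definition holds (x : V -> R) (c : constraint) : bool :=
  match c with
  | LeC e f => aval x e <= aval x f
  | EqC e f => aval x e == aval x f
  end.

Definition feasible (s : seq constraint) : set (V -> R) :=
  [set x | all (holds x) s].

End LinearSystems.

Declare Scope constraint_scope.
Delimit Scope constraint_scope with C.
Notation "e <= f" := (LeC e f) : constraint_scope.
Notation "e = f" := (EqC e f) : constraint_scope.

Section Weights.
Context (R : realType) (N : nat).
Variables (kin kout : 'I_N -> R) (theta : R).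

Definition K0 : R := N%:R^-1 * \sum_i kout i.

Definition Wset (eps : R) : set 'rV[R]_N :=
  [set w | (forall i, 0 <= w 0 i <= N%:R^-1) /\ eps <= \sum_i w 0 i /\
           K0 + \sum_i (kin i - kout i) * w 0 i <= theta].

Definition fractional (w : 'rV[R]_N) : {set 'I_N} :=
  [set i | 0 < w 0 i < N%:R^-1].

Definition slack (w : 'rV[R]_N) : R :=
  theta - K0 - \sum_i (kin i - kout i) * w 0 i.

Variables (risk : R) (w : 'rV[R]_N).

Definition omega (i : 'I_N) : R := N%:R * w 0 i.

Definition Fset : {set 'I_N} := [set i | omega i == 1].
Definition Jset : {set 'I_N} := [set i | 0 < omega i < 1].
Definition Zset : {set 'I_N} := [set i | omega i == 0].

Definition budget : R := risk * \sum_i omega i.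

Definition pattern := {ffun {j | j \in Jset} -> bool}.

Definition alpha (a : pattern) : R := \sum_j omega (val j) * (a j)%:R.

(* In [Tset], [khat] and [Kset] the [else] branch is the case of positive slack,
   since the slack is nonnegative on [Wset]. *)
Definition Tset : {set pattern} :=
  [set a | if slack w == 0 then alpha a <= budget else alpha a < budget].

Definition khat (a : pattern) : int :=
  if slack w == 0 then Num.floor (budget - alpha a)
  else Num.ceil (budget - alpha a) - 1.

Definition kcard (a : pattern) : int := Num.min (#|Fset|%:Z) (khat a).

Definition Kset : set 'rV[R]_N :=
  [set z | (forall i, z 0 i = 0 \/ z 0 i = 1) /\
    (if slack w == 0 then \sum_i omega i * z 0 i <= budget
     else \sum_i omega i * z 0 i < budget)].

Definition adm := {a : pattern | a \in Tset}.
Definition full := {i | i \in Fset}.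

(* The variables: (z, psi) for [redvar], ((z, psi), y) for [extvar]. *)
Definition redvar := ('I_N + adm)%type.
Definition extvar := (redvar + full * adm)%type.

Section Families.
Variables (V : finType) (z : 'I_N -> affine R V) (psi : adm -> affine R V).

Definition pattern_constraints : seq (constraint R V) :=
  [:: (\sum_(a : adm) psi a = acst V 1)%C]
  ++ [seq (0 <= psi a)%C | a : adm]
  ++ [seq (z (val j) = \sum_(a : adm) (val a j)%:R *: psi a)%C | j : {j | j \in Jset}].

Definition box_constraints : seq (constraint R V) :=
  [seq (0 <= z i)%C | i in Zset] ++ [seq (z i <= acst V 1)%C | i in Zset].

Definition y_constraints (y : full -> adm -> affine R V) :
    seq (constraint R V) :=
  [seq (z (val i) = \sum_(a : adm) y i a)%C | i : full]
  ++ [seq (\sum_(i : full) y i a <= (kcard (val a))%:~R *: psi a)%C | a : adm]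
  ++ [seq (0 <= y i a)%C | i <- enum {: full}, a <- enum {: adm}]
  ++ [seq (y i a <= psi a)%C | i <- enum {: full}, a <- enum {: adm}].

Definition cut (S : {set 'I_N}) : constraint R V :=
  (\sum_(i in S) z i
     <= \sum_(a : adm) (Num.min (#|S|%:Z) (kcard (val a)))%:~R *: psi a)%C.

End Families.

Definition ext_system : seq (constraint R extvar) :=
  let z i := avar R (inl (inl i) : extvar) in
  let psi a := avar R (inl (inr a) : extvar) in
  let y i a := avar R (inr (i, a) : extvar) in
  pattern_constraints z psi ++ y_constraints z psi y ++ box_constraints z.

Definition red_cut : {set 'I_N} -> constraint R redvar :=
  cut (fun i => avar R (inl i : redvar)) (fun a => avar R (inr a : redvar)).

Definition red_system : seq (constraint R redvar) :=
  let z i := avar R (inl i : redvar) in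
  let psi a := avar R (inr a : redvar) in
  pattern_constraints z psi
  ++ [seq (0 <= z i)%C | i : 'I_N]
  ++ [seq red_cut A | A : {set 'I_N} in powerset Fset]
  ++ box_constraints z.

Definition sorted_full (x : redvar -> R) : seq 'I_N :=
  sort (fun i j => x (inl j) <= x (inl i)) (enum Fset).

(* The right-hand side of a cut depends only on the cardinality of the set, so
   only the prefixes of the sorted sequence are tested. *)
Definition separate (x : redvar -> R) : option {set 'I_N} :=
  ohead [seq A <- [seq [set i in take m (sorted_full x)]
                  | m <- iota 1 #|Fset|]
        | ~~ holds x (red_cut A)].

End Weights.

(* Main.v *)
Require Import Defs.
From HB Require Import structures.
From mathcomp Require Import all_boot all_order all_algebra.
From mathcomp Require Import all_classical all_reals all_analysis.
From mathcomp Require Import lra ring zify.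

Set Implicit Arguments.
Unset Strict Implicit.
Unset Printing Implicit Defensive.

Import Order.TTheory GRing.Theory Num.Theory. 
Import numFieldNormedType.Exports.

Local Open Scope classical_set_scope.
Local Open Scope ring_scope.

(** Vertices. The polytope of weights is a box cut by two inequalities. If a point
    of it had three fractional components, two linear equations in three unknowns
    would give a direction along which both inequalities are kept with equality
    of their left-hand sides and the point can be moved both ways
    ([vertex_fractional]).

    Convex hull. Fix a 0/1 pattern a on the fractional components J. The full
    components F all have weight one and the components in Z weight zero, so the
    knapsack constraint leaves just a bound k_a on the number of ones in F
    ([Kset_pattern]). The cube with one cardinality constraint has integral
    vertices ([capped_cube_hull]), and the extended formulation is the disjunctive
    formulation of the union of these faces over the admissible patterns: psi_a is
    the weight of the pattern a in a convex combination, and y^a is psi_a times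
    the point of the face ([conv_hull_ext]).

    Elimination of y. For fixed z and psi the variables y solve a transportation
    problem, z_i being the sum of the y_i^a, with 0 <= y_i^a <= psi_a and the sum
    of the y_i^a over i at most k_a psi_a. The cuts are the conditions of its
    minimum cuts. Their sufficiency is proved pattern by pattern ([transport]): a
    pattern takes the part of z above a common level, cut off at psi_a, and the
    remainder satisfies the cuts of the other patterns because the right-hand
    side of a cut is a concave function of the cardinality ([peel_pattern]).

    Separation. For a given cardinality the most violated cut is that of the
    largest components, a prefix of the sorted sequence ([separateP]). *)

(** * Majorization and the transportation problem *)

Section TopSets.
Context (R : realType) (I : finType).
Implicit Types (r z : I -> R) (S T F : {set I}).

(** Trading the elements of S outside T for those of T outside S can only
    increase the sum. *)
Lemma ler_sum_top r S T : #|S| = #|T| ->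
  (forall i j, i \in T -> j \in S -> j \notin T -> r j <= r i) ->
  \sum_(i in S) r i <= \sum_(i in T) r i.
Proof.
move=> eST topT.
rewrite (big_setID T) /= [leRHS](big_setID S) /= finset.setIC lerD2l.
have eD : #|S :\: T| = #|T :\: S| by rewrite !cardsD eST finset.setIC.
have [e0|[j0 j0D]] := set_0Vmem (T :\: S).
  by move: eD; rewrite e0 cards0 => /cards0_eq ->.
case: (arg_minP r j0D) => m /setDP[mT mS] mmin.
apply: (@le_trans _ _ (\sum_(i in S :\: T) r m)).
  by apply: ler_sum => i /setDP[iS iT]; exact: topT.
rewrite sumr_const eD -sumr_const.
by apply: ler_sum => i iD; exact: mmin.
Qed.

(** Cut out of the sorted sequence, and not merely characterized by its largest
    entries, so as to coincide with the sets that the separation tests. *)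
Definition top_set z (F : {set I}) (m : nat) : {set I} :=
  [set i in take m (sort (fun i j => z j <= z i) (enum F))].

Lemma top_set_sub z F m : top_set z F m \subset F.
Proof. by apply/fintype.subsetP => i; rewrite inE => /mem_take; rewrite mem_sort mem_enum. Qed.

Lemma card_top_set z F m : (m <= #|F|)%N -> #|top_set z F m| = m.
Proof.
move=> mF; rewrite cardsE (card_uniqP _) ?take_uniq ?sort_uniq ?enum_uniq //.
by rewrite size_takel // size_sort -cardE.
Qed.

Lemma top_setP z F m i j :
  i \in top_set z F m -> j \in F -> j \notin top_set z F m -> z j <= z i.
Proof.
set e := fun i j => z j <= z i; set s := sort e (enum F).
rewrite !inE -/e -/s => it jF jt.
have : pairwise e s.
  rewrite -sorted_pairwise; first by apply: sort_sorted => x y; exact: le_total.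
  by move=> x y t xy yt; exact: le_trans yt xy.
rewrite -(cat_take_drop m s) pairwise_cat => /and3P[/allrelP/(_ i j it) h _ _].
apply: h; have : j \in s by rewrite mem_sort mem_enum.
by rewrite -[in X in X -> _](cat_take_drop m s) mem_cat (negPf jt).
Qed.

End TopSets.

Section Transport.
Context (R : realType) (I : finType).
Implicit Types (z : I -> R) (p k lam : R).

(** The level lam of the greedy filling of one pattern of weight p and capacity
    k * p: each coordinate gives the part of it above lam, cut off at p. The
    total is continuous in lam and vanishes for lam large, so either lam = 0
    already respects the capacity or some lam meets it exactly. *)
Lemma water_level z p k : 0 <= p -> 0 <= k -> (forall i, 0 <= z i) ->
  exists2 lam, 0 <= lam &
    \sum_i Num.min p (Num.max (z i - lam) 0) <= k * p /\
    (lam = 0 \/ \sum_i Num.min p (Num.max (z i - lam) 0) = k * p).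
Proof.
move=> p0 k0 z0; pose f lam := \sum_i Num.min p (Num.max (z i - lam) 0).
have [f0|f0] := leP (f 0) (k * p); first by exists 0 => //; split; [|left].
have L0 : 0 <= \sum_i z i by exact: sumr_ge0.
have fL : f (\sum_i z i) = 0.
  rewrite /f big1 // => i _; rewrite max_r ?min_r //.
  by rewrite subr_le0 (bigD1 i) //= lerDl sumr_ge0.
have cf : continuous f.
  apply: continuous_big => [|i _ lam]; first exact: add_continuous.
  apply: (@continuous_min R R (fun=> p) (fun lam => Num.max (z i - lam) 0)).
    exact: cvg_cst.
  apply: (@continuous_max R R (fun lam => z i - lam) (fun=> 0)).
    apply: (@continuousB R R^o R (fun=> z i) id); first exact: cvg_cst.
    exact: cvg_id.
  exact: cvg_cst.
have [||lam] := @IVT R f 0 (\sum_i z i) (k * p) L0.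
- exact: continuous_subspaceT.
- by rewrite fL ge_min le_max (ltW f0) (mulr_ge0 k0 p0) orbT.
rewrite in_itv /= => /andP[lam0 _] flam.
by exists lam => //; rewrite -/(f lam) flam; split => //; right.
Qed.

(** One pattern is served greedily, above the water level, and what is left of z
    still satisfies the cuts of the other patterns, whose right-hand side is a
    nondecreasing concave function G of the cardinality. The remainder r = z - y
    is a nondecreasing function of z, so only top sets of z matter. On those, r
    is z - p above the level lam + p, it is constantly lam between lam and
    lam + p, and below lam the whole capacity k * p has been used. *)
Lemma peel_pattern z p k (G : nat -> R) :
  0 <= p -> 0 <= k -> (forall i, 0 <= z i) ->
  {homo G : m n / (m <= n)%N >-> m <= n} ->
  (forall h s e : nat, (h <= s)%N -> (s <= e)%N ->
     (e%:R - s%:R) * G h + (s%:R - h%:R) * G e <= (e%:R - h%:R) * G s) ->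
  (forall S : {set I}, \sum_(i in S) z i <= G #|S| + p * Num.min #|S|%:R k) ->
  exists y : I -> R,
    [/\ forall i, 0 <= y i <= p, forall i, y i <= z i, \sum_i y i <= k * p &
        forall S : {set I}, \sum_(i in S) (z i - y i) <= G #|S|].
Proof.
move=> p0 k0 z0 Gm Gc zG.
have [lam lam0 [Yk Ylam]] := water_level p0 k0 z0.
pose y i := Num.min p (Num.max (z i - lam) 0).
exists y; split => //.
- by move=> i; rewrite ge_min lexx le_min p0 le_max lexx orbT.
- by move=> i; rewrite ge_min ge_max z0 gerBl lam0 orbT.
pose r i := z i - y i.
have rm i j : z i <= z j -> r i <= r j.
  move=> zij; rewrite /r /y.
  by case: (leP (z i - lam) 0) => ?; case: (leP (z j - lam) 0) => ?;
    do ?case: (leP p _) => ?; lra.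
pose H : {set I} := [set i | lam + p < z i]%SET.
pose E : {set I} := [set i | lam <= z i]%SET.
have rH i : i \in H -> r i = z i - p.
  rewrite inE /r /y => h; case: (leP (z i - lam) 0) => ?; first lra.
  by case: (leP p _) => ?; lra.
have rM i : i \in E -> i \notin H -> r i = lam.
  rewrite !inE -leNgt /r /y => h1 h2; case: (leP (z i - lam) 0) => ?.
    by case: (leP p _) => ?; lra.
  by case: (leP p _) => ?; lra.
have yE i : i \notin E -> y i = 0.
  rewrite inE -ltNge /y => h; have zl : z i - lam <= 0 by lra.
  by rewrite max_r ?min_r.
have HE : H \subset E by apply/fintype.subsetP => i; rewrite !inE => ?; lra.
have rsub (T : {set I}) : \sum_(i in T) r i = \sum_(i in T) z i - \sum_(i in T) y i.
  exact: sumrB.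
have subH (T : {set I}) : T \subset H -> \sum_(i in T) r i <= G #|T|.
  move=> /fintype.subsetP TH; rewrite (eq_bigr (fun i => z i - p)); last first.
    by move=> i /TH /rH.
  rewrite sumrB sumr_const -mulr_natr; have := zG T.
  by case: (leP #|T|%:R k) => h ?; [lra|have := ler_wpM2l p0 (ltW h); lra].
have supE (T : {set I}) : E \subset T -> \sum_i y i = k * p -> \sum_(i in T) r i <= G #|T|.
  move=> /fintype.subsetP ET eY; rewrite rsub.
  have -> : \sum_(i in T) y i = k * p.
    rewrite -eY [RHS](bigID (mem T)) /= [X in _ + X]big1 ?addr0 // => i iT.
    by apply: yE; apply: contra iT => /ET.
  have := zG T; have : p * Num.min #|T|%:R k <= k * p.
    by rewrite mulrC ler_wpM2r // ge_min lexx orbT.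
  lra.
have rHD (T : {set I}) : H \subset T -> T \subset E ->
    \sum_(i in T) r i = \sum_(i in H) r i + lam * (#|T|%:R - #|H|%:R).
  move=> HT /fintype.subsetP TE; rewrite (big_setID H) /= (finset.setIidPr HT); congr (_ + _).
  rewrite (eq_bigr (fun=> lam)) => [|i /setDP[/TE iE iH]]; last exact: rM.
  by rewrite sumr_const cardsD (finset.setIidPr HT) -natrB ?subset_leq_card // mulr_natr.
move=> S.
have ST : (#|S| <= #|[set: I]%SET|)%N by rewrite cardsT max_card.
pose T := top_set z [set: I]%SET #|S|.
have cT : #|T| = #|S| by exact: card_top_set.
have ttop i j : i \in T -> j \notin T -> z j <= z i.
  by move=> iT jT; apply: top_setP iT _ jT; rewrite inE.
rewrite -cT; apply: (@le_trans _ _ (\sum_(i in T) r i)).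
  by apply: ler_sum_top => // i j iT _ jT; apply/rm/ttop.
(* Top sets and upper level sets of z form one chain, so T lies below H, between
   H and E, or above E. *)
have cmp (L : {set I}) : (forall i j, i \in L -> j \notin L -> z j < z i) ->
    T \subset L \/ L \subset T.
  move=> Lup; have [TL|/fintype.subsetPn[i iT iL]] := boolP (T \subset L); [by left|right].
  apply/fintype.subsetP => j jL; apply: contraT => jT.
  by have := ttop _ _ iT jT; rewrite leNgt Lup.
have [|TH|HT] := cmp H; [by move=> i j; rewrite !inE; lra|exact: subH|].
have hT := subset_leq_card HT.
case: Ylam => [lam00|eY].
  have TE : T \subset E by apply/fintype.subsetP => i _; rewrite inE lam00.
  rewrite (rHD _ HT TE) lam00 mul0r addr0.
  exact: le_trans (subH _ (subxx _)) (Gm _ _ hT).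
have [|TE|] := cmp E; [by move=> i j; rewrite !inE; lra| |by move=> ET; exact: supE].
have [eHE|] := eqVneq #|E| #|H|.
  apply: subH; have /eqP -> : H == E by rewrite eqEcard HE eHE leqnn.
  by [].
move=> nHE; have hE : #|H|%:R < #|E|%:R :> R.
  by rewrite ltr_nat ltn_neqAle eq_sym nHE subset_leq_card.
have tE : #|T|%:R <= #|E|%:R :> R by rewrite ler_nat subset_leq_card.
have hT' : #|H|%:R <= #|T|%:R :> R by rewrite ler_nat.
(* Between H and E the sum of r grows linearly with the cardinality, so concavity
   of G carries the bounds at H and at E over to T. *)
have := Gc _ _ _ hT (subset_leq_card TE).
have := subH _ (subxx H); have := supE _ (subxx E) eY.
rewrite (rHD _ HE (subxx _)) (rHD _ HT TE).
move: (\sum_(i in H) r i) (G _) (G _) (G _) => rh ge gt gh.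
move: hE tE hT'; move: #|H|%:R #|T|%:R #|E|%:R => h t e he te ht rE rh_ c.
rewrite -(ler_pM2l (_ : 0 < e - h)) ?subr_gt0 //; apply: le_trans c.
apply: (@le_trans _ _ ((e - t) * rh + (t - h) * (rh + lam * (e - h)))).
  by rewrite le_eqVlt; apply/orP; left; apply/eqP; ring.
by apply: lerD; apply: ler_wpM2l => //; rewrite subr_ge0.
Qed.

Lemma min_concave (k h s e : R) : h <= s -> s <= e ->
  (e - s) * Num.min h k + (s - h) * Num.min e k <= (e - h) * Num.min s k.
Proof.
move=> hs se.
have bnd m : Num.min h k <= m -> Num.min e k <= m + (m - m) ->
  (e - s) * Num.min h k + (s - h) * Num.min e k <= (e - h) * m.
  rewrite subrr addr0 => h1 h2; have -> : (e - h) * m = (e - s) * m + (s - h) * m by ring.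
  by apply: lerD; apply: ler_wpM2l => //; rewrite subr_ge0.
case: (leP s k) => sk; last by apply: bnd; rewrite ?subrr ?addr0 ge_min lexx orbT.
have -> : (e - h) * s = (e - s) * h + (s - h) * e by ring.
by apply: lerD; apply: ler_wpM2l; rewrite ?subr_ge0 // ge_min lexx.
Qed.

(** A supply and demand theorem: z splits into parts y^a of weight psi_a and total
    at most k_a psi_a as soon as z satisfies the cuts. Each psi_a min(s, k_a) is
    nondecreasing and concave in s, and so is the sum over the patterns that
    remain after one of them has been peeled off. *)
Lemma transport (T : finType) z (psi k : T -> R) :
  (forall a, 0 <= psi a) -> (forall a, 0 <= k a) -> (forall i, 0 <= z i) ->
  (forall S : {set I},
     \sum_(i in S) z i <= \sum_a psi a * Num.min #|S|%:R (k a)) ->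
  exists y : I -> T -> R,
    [/\ forall i a, 0 <= y i a <= psi a,
        forall a, \sum_i y i a <= k a * psi a &
        forall i, z i = \sum_a y i a].
Proof.
move=> psi0 k0; rewrite /index_enum; move: (Finite.enum T) (enumT T).
move=> s es; have us : uniq s by rewrite -es enum_uniq.
suff : forall z, (forall i, 0 <= z i) ->
  (forall S : {set I},
     \sum_(i in S) z i <= \sum_(a <- s) psi a * Num.min #|S|%:R (k a)) ->
  exists y : I -> T -> R,
    [/\ forall i a, 0 <= y i a <= psi a,
        forall a, \sum_i y i a <= k a * psi a &
        forall i, z i = \sum_(a <- s) y i a] by exact.
elim: s us {es} => [_|a s IH /= /andP[as_ us]] {}z z0 zS.
  exists (fun _ _ => 0); split => [i a|a|i]; first by rewrite lexx psi0.
    by rewrite big1 // mulr_ge0.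
  apply: le_anti; rewrite big_nil z0 andbT.
  by have := zS [set i]%SET; rewrite big_set1 big_nil.
pose G (n : nat) := \sum_(b <- s) psi b * Num.min n%:R (k b).
have [|||y0 [y01 y0z y0k y0S]] := @peel_pattern z (psi a) (k a) G (psi0 a) (k0 a) z0.
- move=> m n mn; apply: ler_sum => b _; apply: ler_wpM2l => //.
  have mnR : m%:R <= n%:R :> R by rewrite ler_nat.
  by rewrite le_min !ge_min mnR lexx orbT.
- move=> h t e ht te; rewrite /G !mulr_sumr -big_split /=; apply: ler_sum => b _.
  rewrite !(mulrCA _ (psi b)) -mulrDr; apply: ler_wpM2l => //.
  by apply: min_concave; rewrite ler_nat.
- by move=> S; rewrite addrC -/G; have := zS S; rewrite big_cons.
have [||y [y1 yk yz]] := IH us (fun i => z i - y0 i).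
- by move=> i; rewrite subr_ge0.
- exact: y0S.
exists (fun i b => if b == a then y0 i else y i b); split.
- by move=> i b; case: eqP => [->|_].
- by move=> b; case: eqP => [->|_].
move=> i; rewrite big_cons eqxx; have := yz i => /eqP; rewrite subr_eq addrC => /eqP ->.
congr (_ + _); apply: eq_big_seq => b bs; case: eqP => // ba.
by rewrite ba (negPf as_) in bs.
Qed.

End Transport.

(** * Convex hulls *)

Section Convexity.
Context (R : realType) (N : nat).
Implicit Types (C : set 'rV[R]_N) (u v d : 'rV[R]_N).

Lemma convex_setE C : convex_set C <->
  forall u v (t : R), 0 <= t <= 1 -> C u -> C v -> C (t *: u + (1 - t) *: v).
Proof.
split=> [Cc u v t /andP[t0 t1] Cu Cv|Cc u v t].
  by have := Cc u v (Itv01 t0 t1); rewrite !inE; exact.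
by rewrite !inE => Cu Cv; apply: Cc => //; rewrite ge0 le1.
Qed.

Lemma convex_segment C u d (s t : R) : convex_set C ->
  0 <= s -> 0 < t -> C (u + s *: d) -> C (u - t *: d) -> C u.
Proof.
move=> /convex_setE Cc s0 t0 Cs Ct.
have st0 : s + t != 0 by apply: lt0r_neq0; lra.
suff -> : u = t / (s + t) *: (u + s *: d) + (1 - t / (s + t)) *: (u - t *: d).
  apply: Cc => //; rewrite divr_ge0 /= ?ler_pdivrMr; lra.
apply/rowP => i; rewrite !mxE; field; exact: st0.
Qed.

(** The points x a of weight zero need not belong to C. The induction runs over the
    pairs (t, v) of the cone over C. *)
Lemma convex_combination (T : finType) C (psi : T -> R) (x : T -> 'rV[R]_N) :
  convex_set C -> (forall a, 0 <= psi a) -> \sum_a psi a = 1 ->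
  (forall a, 0 < psi a -> C (x a)) -> C (\sum_a psi a *: x a).
Proof.
move=> /convex_setE Cc psi0 psi1 Cx.
pose K (t : R) v := t = 0 /\ v = 0 \/ 0 < t /\ exists2 c, C c & v = t *: c.
have : K (\sum_a psi a) (\sum_a psi a *: x a).
  apply: big_ind2 => [|s u t v|a _]; first by left.
  - case=> [[-> ->]|[s0 [c Cs ->]]]; first by rewrite !add0r.
    case=> [[-> ->]|[t0 [e Ct ->]]].
      by right; rewrite !addr0; split => //; exists c.
    right; split; first exact: addr_gt0.
    have st0 : s + t != 0 by apply: lt0r_neq0; lra.
    exists (s / (s + t) *: c + (1 - s / (s + t)) *: e).
      by apply: Cc => //; rewrite divr_ge0 /= ?ler_pdivrMr; lra.
    by apply/rowP => i; rewrite !mxE; field; exact: st0.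
  - have := psi0 a; rewrite le_eqVlt => /orP[/eqP <-|a0].
      by left; rewrite scale0r.
    by right; split => //; exists (x a) => //; exact: Cx.
rewrite psi1 => -[[/eqP]|[_ [c Cc' ->]]]; last by rewrite scale1r.
by rewrite oner_eq0.
Qed.

Definition nonint (u : 'rV[R]_N) : {set 'I_N} := [set i | 0 < u 0 i < 1]%SET.

Lemma nonint_shift u d (s : R) i0 : i0 \in nonint u ->
  (forall i, i \notin nonint u -> d 0 i = 0) ->
  (u + s *: d) 0 i0 = 0 \/ (u + s *: d) 0 i0 = 1 ->
  (#|nonint (u + s *: d)| < #|nonint u|)%N.
Proof.
move=> iu d0 vi; apply/proper_card/properP; split.
  apply/fintype.subsetP => i; rewrite inE => vi01.
  by apply: contraT => iN; move: vi01; rewrite !mxE (d0 _ iN) mulr0 addr0 => h;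
    rewrite inE h in iN.
by exists i0 => //; rewrite inE; case: vi => ->; rewrite ltxx ?andbF.
Qed.

(** Integrality of the cube cut by one cardinality constraint with an integral
    right-hand side. A point with two fractional coordinates in F lies on a
    segment along which these two are exchanged at constant sum; any other
    fractional coordinate can be rounded both ways on its own. Either way the
    endpoints have fewer fractional coordinates. Rounding never changes an
    integral coordinate, so it suffices that C contains the roundings of u. *)
Lemma capped_cube_hull C (F : {set 'I_N}) (k : int) u : convex_set C ->
  (forall v, (forall i, v 0 i = 0 \/ v 0 i = 1) ->
     (forall i, i \notin nonint u -> v 0 i = u 0 i) ->
     \sum_(i in F) v 0 i <= k%:~R -> C v) ->
  (forall i, 0 <= u 0 i <= 1) -> \sum_(i in F) u 0 i <= k%:~R -> C u.
Proof.
move=> Cc; have [m] := ubnP #|nonint u|; elim: m u => // m IH u um Cv u01 uk.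
have step d (s : R) (i0 : 'I_N) : i0 \in nonint u ->
    (forall i, i \notin nonint u -> d 0 i = 0) ->
    (forall i, 0 <= (u + s *: d) 0 i <= 1) ->
    (u + s *: d) 0 i0 = 0 \/ (u + s *: d) 0 i0 = 1 ->
    \sum_(i in F) (u + s *: d) 0 i <= k%:~R -> C (u + s *: d).
  move=> iu d0 v01 vi vk; have lt := nonint_shift iu d0 vi.
  apply: IH => //; first exact: leq_trans lt _.
  move=> v vint vu; apply: Cv => // i iN; rewrite vu.
    by rewrite !mxE (d0 _ iN) mulr0 addr0.
  apply: contra iN; rewrite !inE !mxE => h; apply: contraT => iN.
  by move: h; rewrite d0 ?inE // mulr0 addr0 => h; rewrite h in iN.
have fracI i : i \in nonint u -> 0 < u 0 i < 1 by rewrite inE.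
have intI i : i \notin nonint u -> u 0 i = 0 \/ u 0 i = 1.
  rewrite inE negb_and -!leNgt => /orP[] h; have /andP[? ?] := u01 i; [left|right];
    by apply: le_anti; apply/andP.
have [u0|[p pu]] := set_0Vmem (nonint u).
  by apply: Cv => // i; apply: intI; rewrite u0 inE.
have [p0 p1] := andP (fracI _ pu).
have Fsum d (s : R) : \sum_(i in F) (u + s *: d) 0 i =
    \sum_(i in F) u 0 i + s * \sum_(i in F) d 0 i.
  by rewrite mulr_sumr -big_split /=; apply: eq_bigr => i _; rewrite !mxE.
have deltaE (j i : 'I_N) : (delta_mx 0 j : 'rV[R]_N) 0 i = (i == j)%:R.
  by rewrite mxE.
have deltaF (j : 'I_N) : \sum_(i in F) (delta_mx 0 j : 'rV[R]_N) 0 i = (j \in F)%:R.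
  under eq_bigr do rewrite deltaE.
  have [jF|jF] := boolP (j \in F).
    by rewrite (bigD1 j) //= eqxx big1 ?addr0 // => i /andP[_ /negPf ->].
  by rewrite big1 // => i iF; case: eqP => // ij; rewrite -ij iF in jF.
have rowE d (s : R) i : (u + s *: d) 0 i = u 0 i + s * d 0 i by rewrite !mxE.
have [l|] := boolP ((p \notin F) || (nonint u :&: F == [set p])%SET).
  have d0 i : i \notin nonint u -> (delta_mx 0 p : 'rV[R]_N) 0 i = 0.
    by rewrite deltaE; case: eqP => // -> ; rewrite pu.
  have q0 : 0 <= 1 - u 0 p by lra.
  apply: (@convex_segment C u (delta_mx 0 p) (1 - u 0 p) (u 0 p)) => //.
    apply: (step _ _ p) => //.
    + move=> i; rewrite rowE deltaE; case: eqP => [->|_]; last by rewrite mulr0 addr0.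
      by rewrite mulr1; lra.
    + by right; rewrite rowE deltaE eqxx mulr1; lra.
    + rewrite Fsum deltaF; case/orP: l => [/negPf ->|/eqP eF].
        by rewrite mulr0 addr0.
      have pF : p \in F by have : p \in (nonint u :&: F)%SET; [rewrite eF inE|case/setIP].
      rewrite pF mulr1 (big_setD1 p pF) /=.
      (* The coordinates in F other than p add up to an integer m', which is less than
         k because u 0 p > 0; so raising the coordinate p to 1 respects k. *)
      have [m' em] : exists m' : int, \sum_(i in (F :\ p)%SET) u 0 i = m'%:~R.
        apply: (big_ind (fun x : R => exists m' : int, x = m'%:~R)).
        * by exists 0.
        * by move=> x y [a ->] [b ->]; exists (a + b); rewrite intrD.
        * move=> i /setD1P[ip iF].
          have iN : i \notin nonint u.
            by apply: contra ip => iu; rewrite -finset.in_set1 -eF inE iu.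
          by case: (intI _ iN) => ->; [exists 0|exists 1].
      move: uk; rewrite (big_setD1 p pF) /= em => uk.
      have : m' < k by rewrite -(ltr_int R); lra.
      rewrite -lezD1 -(ler_int R) intrD; lra.
  rewrite -scaleNr; apply: (step _ _ p) => //.
  + move=> i; rewrite rowE deltaE; case: eqP => [->|_]; last by rewrite mulr0 addr0.
    by rewrite mulr1; lra.
  + by left; rewrite rowE deltaE eqxx mulr1; lra.
  + rewrite Fsum deltaF; have : 0 <= (p \in F)%:R :> R by rewrite ler0n.
    by move=> /(mulr_ge0 (ltW p0)); rewrite mulNr; lra.
rewrite negb_or negbK => /andP[pF nF].
have [q /setIP[qu qF] qp] : exists2 q, q \in (nonint u :&: F)%SET & q != p.
  apply/exists_inP; apply: contraNT nF => /exists_inPn h.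
  rewrite finset.eqEsubset; apply/andP; split; apply/fintype.subsetP => i.
    by move=> /h; rewrite negbK inE.
  by rewrite inE => /eqP ->; rewrite inE pu.
have [q0 q1] := andP (fracI _ qu).
pose d : 'rV[R]_N := delta_mx 0 p - delta_mx 0 q.
have dE i : d 0 i = (i == p)%:R - (i == q)%:R by rewrite /d mxE [X in _ + X]mxE !deltaE.
have dF : \sum_(i in F) d 0 i = 0.
  under eq_bigr do rewrite dE -!deltaE.
  by rewrite sumrB !deltaF pF qF subrr.
have d0 i : i \notin nonint u -> d 0 i = 0.
  move=> iN; rewrite dE; case: eqP => [ip|_]; first by rewrite -ip (negPf iN) in pu.
  by case: eqP => [iq|_]; [rewrite -iq (negPf iN) in qu|rewrite subrr].
have move_d (s : R) : 0 <= u 0 p + s <= 1 -> 0 <= u 0 q - s <= 1 ->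
    (u 0 p + s = 1 \/ u 0 q - s = 0) \/ (u 0 p + s = 0 \/ u 0 q - s = 1) ->
    C (u + s *: d).
  move=> hp hq hs.
  have vp : (u + s *: d) 0 p = u 0 p + s.
    by rewrite rowE dE eqxx eq_sym (negPf qp) subr0 mulr1.
  have vq : (u + s *: d) 0 q = u 0 q - s.
    by rewrite rowE dE eqxx (negPf qp) sub0r mulrN1.
  have v01 i : 0 <= (u + s *: d) 0 i <= 1.
    have [->|ip] := eqVneq i p; first by rewrite vp.
    have [->|iq] := eqVneq i q; first by rewrite vq.
    by rewrite rowE dE (negPf ip) (negPf iq) subrr mulr0 addr0.
  have vF : \sum_(i in F) (u + s *: d) 0 i <= k%:~R by rewrite Fsum dF mulr0 addr0.
  have [h|h] : ((u + s *: d) 0 p = 0 \/ (u + s *: d) 0 p = 1) \/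
               ((u + s *: d) 0 q = 0 \/ (u + s *: d) 0 q = 1).
    by rewrite vp vq; tauto.
  - exact: (step _ _ p).
  - exact: (step _ _ q).
apply: (@convex_segment C u d (Num.min (1 - u 0 p) (u 0 q)) (Num.min (u 0 p) (1 - u 0 q))) => //.
- by rewrite le_min; lra.
- by rewrite lt_min; lra.
- by apply: move_d; case: (leP (1 - u 0 p)) => ?; [lra|lra|lra|lra| |]; left; [left|right]; lra.
- rewrite -scaleNr.
  by apply: move_d; case: (leP (u 0 p)) => ?; [lra|lra|lra|lra| |]; right; [left|right]; lra.
Qed.

End Convexity.

(** * Vertices of the set of weights *)

Section Vertices.
Context (R : realType) (N : nat).
Variables (kin kout : 'I_N -> R) (theta eps : R).

(** Two linear equations in three unknowns have a nonzero solution: the cross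
    product of (1, 1, 1) and (a, b, c), which vanishes only if a = b = c. *)
Lemma balanced_triple (a b c : R) : exists p : R * R * R,
  [/\ p != 0, p.1.1 + p.1.2 + p.2 = 0 & a * p.1.1 + b * p.1.2 + c * p.2 = 0].
Proof.
have [abc|abc] := eqVneq (c - b, a - c, b - a) 0.
  case: abc => cb ac ba; exists (1, -1, 0) => /=; split; [|lra|lra].
  by apply/eqP => -[/eqP]; rewrite oner_eq0.
by exists (c - b, a - c, b - a); split => //=; ring.
Qed.

Lemma small_step (w d : 'rV[R]_N) : (forall i, 0 <= w 0 i <= N%:R^-1) ->
  (forall i, i \notin fractional w -> d 0 i = 0) ->
  exists2 s : R, 0 < s & forall i, `|s * d 0 i| <= w 0 i /\
                                   `|s * d 0 i| <= N%:R^-1 - w 0 i.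
Proof.
move=> w01 dz.
pose s i : R := if i \in fractional w
  then Num.min (w 0 i) (N%:R^-1 - w 0 i) / (1 + `|d 0 i|) else 1.
have d1 i : 0 < 1 + `|d 0 i| by rewrite ltr_wpDr.
have s0 i : 0 < s i.
  rewrite /s; case: ifP => //; rewrite inE => /andP[h1 h2].
  by rewrite divr_gt0 // lt_min h1 subr_gt0.
exists (\big[Num.min/1]_i s i); first by apply: lt_bigmin.
move=> i; set t := \big[_/_]_ _ _.
have t0 : 0 < t by apply: lt_bigmin.
have ti : t <= s i by apply: bigmin_le_cond.
have [iF|iF] := boolP (i \in fractional w); last first.
  have /andP[h1 h2] := w01 i.
  by rewrite dz // mulr0 normr0 subr_ge0.
suff : `|t * d 0 i| <= Num.min (w 0 i) (N%:R^-1 - w 0 i) by rewrite le_min => /andP.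
rewrite normrM (gtr0_norm t0).
move: ti; rewrite /s iF ler_pdivlMr // => ti; apply: le_trans ti.
by rewrite ler_wpM2l ?(ltW t0) // lerDr.
Qed.

(** Besides the bounds on the single components, only two inequalities constrain w.
    With three fractional components there is a nonzero direction supported on
    them along which the left-hand sides of both stay constant, and w can be moved
    a little both ways. *)
Lemma vertex_fractional (w : 'rV[R]_N) :
  vertex (Wset kin kout theta eps) w -> (#|fractional w| <= 2)%N.
Proof.
move=> [[w01 [weps wth]] wext]; rewrite leqNgt; apply/negP.
move=> /card_gt2P[i [j [k [[iF jF kF] [ij jk ki]]]]].
pose kap i := kin i - kout i.
have [[[a b] c] /= [abc0 sum0 kap0]] := balanced_triple (kap i) (kap j) (kap k).
pose d : 'rV[R]_N := a *: delta_mx 0 i + b *: delta_mx 0 j + c *: delta_mx 0 k.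
have dE l : d 0 l = a * (l == i)%:R + b * (l == j)%:R + c * (l == k)%:R.
  by rewrite !mxE.
have delta_sum (f : 'I_N -> R) m : \sum_l f l * (l == m)%:R = f m.
  by rewrite (bigD1 m) //= eqxx mulr1 big1 ?addr0 // => l /negPf ->; rewrite mulr0.
have dsum (f : 'I_N -> R) : \sum_l f l * d 0 l = f i * a + f j * b + f k * c.
  rewrite (eq_bigr (fun l => (a * (f l * (l == i)%:R) + b * (f l * (l == j)%:R))
                             + c * (f l * (l == k)%:R))).
    by rewrite !big_split /= -!mulr_sumr !delta_sum; ring.
  by move=> l _; rewrite dE; ring.
have dz l : l \notin fractional w -> d 0 l = 0.
  move=> lF; rewrite dE; case: eqP => [e|_]; first by rewrite e iF in lF.
  case: eqP => [e|_]; first by rewrite e jF in lF.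
  case: eqP => [e|_]; first by rewrite e kF in lF.
  by rewrite !mulr0 !addr0.
have [s s0 sd] := small_step w01 dz.
have inW (e : R) : `|e| = s -> Wset kin kout theta eps (w + e *: d).
  move=> es; split=> [l|].
    have := sd l; rewrite normrM (gtr0_norm s0) -es -normrM !mxE !ler_norml.
    by move=> [/andP[h1 h2] /andP[h3 h4]]; lra.
  have shift (f : 'I_N -> R) : f i * a + f j * b + f k * c = 0 ->
      \sum_l f l * (w + e *: d) 0 l = \sum_l f l * w 0 l.
    move=> f0; rewrite (eq_bigr (fun l => f l * w 0 l + e * (f l * d 0 l))).
      by rewrite big_split /= -mulr_sumr dsum f0 mulr0 addr0.
    by move=> l _; rewrite !mxE; ring.
  split; last by rewrite shift.
  suff -> : \sum_l (w + e *: d) 0 l = \sum_l w 0 l by [].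
  transitivity (\sum_l 1 * (w + e *: d) 0 l).
    by apply: eq_bigr => l _; rewrite mul1r.
  rewrite shift; last by rewrite !mul1r.
  by apply: eq_bigr => l _; rewrite mul1r.
have d0 : d = 0.
  have e : w + s *: d = w + (- s) *: d.
    apply: (wext _ _ 2^-1).
    - by apply: inW; rewrite gtr0_norm.
    - by apply: inW; rewrite normrN gtr0_norm.
    - lra.
    - by apply/rowP => l; rewrite !mxE; lra.
  have rE (t : R) l : (w + t *: d) 0 l = w 0 l + t * d 0 l.
    by rewrite mxE [X in _ + X]mxE.
  move/rowP: e => e; apply/rowP => l; rewrite [RHS]mxE; have := e l; rewrite !rE => h.
  have : s * d 0 l = 0 by lra.
  by move/eqP; rewrite mulf_eq0 gt_eqF //= => /eqP.
case/negP: abc0; have e l : d 0 l = 0 by rewrite d0 mxE.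
have := e i; have := e j; have := e k; rewrite !dE !eqxx.
rewrite (eq_sym k j) (eq_sym j i) (eq_sym i k) (negPf ij) (negPf jk) (negPf ki).
rewrite !mulr0 !mulr1 !addr0 !add0r => -> -> ->.
exact: eqxx.
Qed.

End Vertices.

(** * Systems of affine constraints *)

Section AffineSystems.
Context (R : realType) (V : finType).
Implicit Types (x y : V -> R) (e f : affine R V).

Lemma avalD x e f : aval x (e + f) = aval x e + aval x f.
Proof.
rewrite /aval ffunE (eq_bigr (fun v => e (Some v) * x v + f (Some v) * x v)).
  by rewrite big_split addrACA.
by move=> v _; rewrite ffunE mulrDl.
Qed.

Lemma aval0 x : aval x 0 = 0.
Proof. by rewrite /aval ffunE big1 ?addr0 // => v _; rewrite ffunE mul0r. Qed.

Lemma avalZ x (c : R) e : aval x (c *: e) = c * aval x e.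
Proof.
rewrite /aval ffunE mulrDr; congr (_ + _); rewrite mulr_sumr.
by apply: eq_bigr => v _; rewrite ffunE mulrA.
Qed.

Lemma aval_sum x (I : finType) (P : pred I) (F : I -> affine R V) :
  aval x (\sum_(i | P i) F i) = \sum_(i | P i) aval x (F i).
Proof. exact: (big_morph (aval x) (avalD x) (aval0 x)). Qed.

Lemma aval_avar x v : aval x (avar R v) = x v.
Proof.
rewrite /aval ffunE add0r (bigD1 v) //= ffunE eqxx mul1r big1 ?addr0 // => u uv.
by rewrite ffunE (inj_eq Some_inj) (negPf uv) mul0r.
Qed.

Lemma aval_acst x (c : R) : aval x (acst V c) = c.
Proof. by rewrite /aval ffunE big1 ?addr0 // => v _; rewrite ffunE mul0r. Qed.

Definition avalE := (avalD, aval0, avalZ, aval_sum, aval_avar, aval_acst).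

Lemma aval_affine x y (t : R) e :
  aval (fun v => t * x v + (1 - t) * y v) e = t * aval x e + (1 - t) * aval y e.
Proof.
rewrite /aval.
rewrite (eq_bigr (fun v => t * (e (Some v) * x v) + (1 - t) * (e (Some v) * y v))).
  by rewrite big_split /= -!mulr_sumr; ring.
by move=> v _; ring.
Qed.

Lemma feasible_convex (s : seq (constraint R V)) x y (t : R) : 0 <= t <= 1 ->
  feasible s x -> feasible s y -> feasible s (fun v => t * x v + (1 - t) * y v).
Proof.
move=> /andP[t0 t1]; rewrite /feasible /=; elim: s => //= c s IH.
move=> /andP[xc /IH{}IH] /andP[yc /IH ->]; rewrite andbT.
case: c xc yc => e f /=; rewrite !aval_affine; last by move=> /eqP -> /eqP ->.
by move=> xc yc; apply: lerD; apply: ler_wpM2l; rewrite ?subr_ge0.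
Qed.

End AffineSystems.

Lemma all_imageP (I : finType) (T : Type) (A : {pred I}) (f : I -> T) (p : pred T) :
  all p [seq f i | i in A] <-> forall i, i \in A -> p (f i).
Proof.
rewrite /image_mem all_map; split=> [/allP h i iA|h].
  by apply: h; rewrite mem_enum.
by apply/allP => i; rewrite mem_enum => /h.
Qed.

(** * The reformulation *)

Section Reformulation.
Context (R : realType) (N : nat).
Variables (kin kout : 'I_N -> R) (theta risk : R) (w : 'rV[R]_N).

Local Notation om := (omega w).
Local Notation F := (Fset w).
Local Notation J := (Jset w).
Local Notation Z := (Zset w).
Local Notation adm := (adm kin kout theta risk w).
Local Notation kc a := (kcard kin kout theta risk a).
Local Notation T := (Tset kin kout theta risk w).
Local Notation K := (Kset kin kout theta risk w).
Local Notation ext := (ext_system kin kout theta risk w).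
Local Notation red := (red_system kin kout theta risk w).

Hypothesis om01 : forall i, 0 <= om i <= 1.

Lemma FJZ_cases i : [\/ i \in F, i \in J | i \in Z].
Proof.
rewrite !inE; have /andP[i0 i1] := om01 i.
have [_|n0] := eqVneq (om i) 0; first by constructor 3.
have [_|n1] := eqVneq (om i) 1; first by constructor 1.
by constructor 2; rewrite !lt_neqAle i0 i1 n1 eq_sym n0.
Qed.

Lemma Jset_notF i : i \in J -> i \notin F.
Proof. by rewrite !inE => /andP[_ h]; rewrite lt_eqF. Qed.

Lemma Zset_notF i : i \in Z -> i \notin F.
Proof. by rewrite !inE => /eqP ->; rewrite eq_sym oner_eq0. Qed.

Lemma Zset_notJ i : i \in Z -> i \notin J.
Proof. by rewrite !inE => /eqP ->; rewrite ltxx. Qed.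

(** A pattern leaves room for m full components if and only if the budget, strict
    or not according to the slack, is respected; floor and ceiling minus one are
    the two ways to round down. *)
Lemma le_kcard (a : pattern w) (m : nat) : (m <= #|F|)%N ->
  (m%:Z <= kc a) = (if slack kin kout theta w == 0
                    then alpha a + m%:R <= budget risk w
                    else alpha a + m%:R < budget risk w).
Proof.
move=> mF; rewrite /kcard le_min lez_nat mF /= /khat; case: ifP => _.
  by rewrite floor_ge_int /= lerBrDl.
by rewrite lerBrDr lezD1 ceil_gt_int ltrBrDl.
Qed.

(** Admissibility is the case m = 0 of the same rounding. *)
Lemma Tset_kcard (a : pattern w) : (a \in T) = (0 <= kc a).
Proof. by rewrite inE (@le_kcard a 0%N) // addr0. Qed.

Lemma weight_split (a : pattern w) (v : 'I_N -> R) :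
  (forall j, v (val j) = (a j)%:R) ->
  \sum_i om i * v i = alpha a + \sum_(i in F) v i.
Proof.
move=> va; rewrite (bigID (mem F)) /= addrC; congr (_ + _); last first.
  by apply: eq_bigr => i; rewrite inE => /eqP ->; rewrite mul1r.
rewrite (bigID (mem J)) /= [X in _ + X]big1 ?addr0; last first.
  move=> i /andP[iF iJ]; have [|| ] := FJZ_cases i; rewrite ?(negPf iF) ?(negPf iJ) //.
  by rewrite inE => /eqP ->; rewrite mul0r.
rewrite (eq_bigl (mem J)); last first.
  by move=> i /=; case: (boolP (i \in J)) => [/Jset_notF ->|]; rewrite ?andbF.
rewrite /alpha big_sub; apply: eq_bigr => j _; by rewrite -va.
Qed.

(** Once the pattern on the fractional components is fixed, the knapsack constraint
    is a cardinality constraint, since full components have weight one and those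
    in Z have weight zero. *)
Lemma Kset_pattern (a : pattern w) (v : 'rV[R]_N) :
  (forall i, v 0 i = 0 \/ v 0 i = 1) -> (forall j, v 0 (val j) = (a j)%:R) ->
  K v <-> \sum_(i in F) v 0 i <= (kc a)%:~R.
Proof.
move=> v01 va.
have [m mF em] : exists2 m : nat, (m <= #|F|)%N & \sum_(i in F) v 0 i = m%:R.
  exists #|[set i in F | v 0 i == 1]%SET|.
    by apply/subset_leq_card/fintype.subsetP => i; rewrite inE => /andP[].
  rewrite (big_setID [set i | v 0 i == 1]%SET) /= [X in _ + X]big1 ?addr0.
    rewrite (eq_bigr (fun=> 1)) => [|i]; last by rewrite !inE => /andP[_ /eqP].
    by rewrite sumr_const; congr (_%:R); apply: eq_card => i; rewrite !inE.
  by move=> i; rewrite !inE => /andP[/negP h _]; case: (v01 i) => // e; case: h; apply/eqP.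
rewrite em pmulrn ler_int le_kcard // /Kset /= (weight_split va) em.
by split=> [[]|].
Qed.

Lemma pattern_constraintsP (V : finType) (z : 'I_N -> affine R V)
    (psi : adm -> affine R V) x zv pv :
  (forall i, aval x (z i) = zv i) -> (forall a, aval x (psi a) = pv a) ->
  all (holds x) (pattern_constraints z psi) <->
  [/\ \sum_a pv a = 1, forall a, 0 <= pv a &
      forall j : {j | j \in J}, zv (val j) = \sum_(a : adm) (val a j)%:R * pv a].
Proof.
move=> /funext <- /funext <- /=.
rewrite /pattern_constraints /= all_cat !avalE; split.
  case/and3P => /eqP s1 /all_imageP h1 /all_imageP h2; split => // [a|j].
    by have := h1 a isT; rewrite /= aval0.
  have := h2 j isT; rewrite /= aval_sum => /eqP ->.
  by apply: eq_bigr => a _; rewrite avalZ.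
case=> s1 h1 h2; apply/and3P; split; first exact/eqP.
  by apply/all_imageP => a _; rewrite /= aval0.
apply/all_imageP => j _; rewrite /= aval_sum h2; apply/eqP.
by apply: eq_bigr => a _; rewrite avalZ.
Qed.

Lemma box_constraintsP (V : finType) (z : 'I_N -> affine R V) x zv :
  (forall i, aval x (z i) = zv i) ->
  all (holds x) (box_constraints w z) <-> forall i, i \in Z -> 0 <= zv i <= 1.
Proof.
move=> /funext <- /=; rewrite /box_constraints all_cat; split.
  case/andP => /all_imageP h1 /all_imageP h2 i iZ.
  by have := h1 i iZ; have := h2 i iZ; rewrite /= aval0 aval_acst => -> ->.
by move=> h; apply/andP; split; apply/all_imageP => i /h /andP[];
  rewrite /= ?aval0 ?aval_acst.
Qed.

Lemma y_constraintsP (V : finType) (z : 'I_N -> affine R V)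
    (psi : adm -> affine R V) (y : full w -> adm -> affine R V) x zv pv yv :
  (forall i, aval x (z i) = zv i) -> (forall a, aval x (psi a) = pv a) ->
  (forall i a, aval x (y i a) = yv i a) ->
  all (holds x) (y_constraints z psi y) <->
  [/\ forall i : full w, zv (val i) = \sum_a yv i a,
      forall a : adm, \sum_i yv i a <= (kc (val a))%:~R * pv a &
      forall i a, 0 <= yv i a <= pv a].
Proof.
move=> /funext <- /funext <- yvE /=.
have <- : (fun i a => aval x (y i a)) = yv.
  by apply/funext => i; apply/funext.
rewrite /y_constraints !all_cat; split.
  case/and4P => /all_imageP h1 /all_imageP h2 /all_allpairsP h3 /all_allpairsP h4.
  split=> [i|a|i a].
  - by have := h1 i isT; rewrite /= aval_sum => /eqP.
  - by have := h2 a isT; rewrite /= aval_sum avalZ.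
  - have := h3 i a (mem_enum _ _) (mem_enum _ _).
    by have := h4 i a (mem_enum _ _) (mem_enum _ _); rewrite /= aval0 => -> ->.
case=> h1 h2 h3; apply/and4P; split.
- by apply/all_imageP => i _; rewrite /= aval_sum h1.
- by apply/all_imageP => a _; rewrite /= aval_sum avalZ.
- by apply/all_allpairsP => i a _ _; rewrite /= aval0; case/andP: (h3 i a).
- by apply/all_allpairsP => i a _ _; case/andP: (h3 i a).
Qed.

Lemma ext_systemP x : feasible ext x <->
  [/\ [/\ \sum_a x (inl (inr a)) = 1, forall a, 0 <= x (inl (inr a)) &
          forall j : {j | j \in J},
            x (inl (inl (val j))) = \sum_(a : adm) (val a j)%:R * x (inl (inr a))],
      [/\ forall i : full w, x (inl (inl (val i))) = \sum_a x (inr (i, a)),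
          forall a : adm, \sum_i x (inr (i, a)) <= (kc (val a))%:~R * x (inl (inr a)) &
          forall i a, 0 <= x (inr (i, a)) <= x (inl (inr a))] &
      forall i, i \in Z -> 0 <= x (inl (inl i)) <= 1].
Proof.
rewrite /feasible /mkset /ext_system; cbv zeta.
rewrite (all_cat _ (pattern_constraints _ _)) (all_cat _ (y_constraints _ _ _)).
have av v : aval x (avar R v) = x v by exact: aval_avar.
have P := pattern_constraintsP (fun i => av (inl (inl i))) (fun a => av (inl (inr a))).
have Y := y_constraintsP (fun i => av (inl (inl i))) (fun a => av (inl (inr a)))
                         (fun i a => av (inr (i, a))).
have B := box_constraintsP (fun i => av (inl (inl i))).
split=> [/and3P[p y b]|[p y b]].
  by split; [exact: (iffLR P p)|exact: (iffLR Y y)|exact: (iffLR B b)].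
by apply/and3P; split; [exact: (iffRL P p)|exact: (iffRL Y y)|exact: (iffRL B b)].
Qed.

Lemma holds_red_cut x (S : {set 'I_N}) :
  holds x (red_cut kin kout theta risk w S) =
  (\sum_(i in S) x (inl i)
     <= \sum_(a : adm) (Num.min #|S|%:R (kc (val a))%:~R) * x (inr a)).
Proof.
rewrite /= !aval_sum; congr (_ <= _); apply: eq_bigr => a _.
  by rewrite aval_avar.
rewrite avalZ aval_avar; congr (_ * _).
by rewrite [in RHS]pmulrn; case: leP => h; rewrite ?ler_int ?ltr_int;
  case: leP => //; rewrite ?ler_int ?ltr_int; move: h; case: leP.
Qed.

Lemma red_systemP x : feasible red x <->
  [/\ [/\ \sum_a x (inr a) = 1, forall a, 0 <= x (inr a) &
          forall j : {j | j \in J},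
            x (inl (val j)) = \sum_(a : adm) (val a j)%:R * x (inr a)],
      forall i, 0 <= x (inl i),
      forall S : {set 'I_N}, S \subset F -> holds x (red_cut kin kout theta risk w S) &
      forall i, i \in Z -> 0 <= x (inl i) <= 1].
Proof.
rewrite /feasible /mkset /red_system; cbv zeta.
rewrite (all_cat _ (pattern_constraints _ _)) (all_cat _ [seq _ | i : 'I_N]).
rewrite (all_cat _ [seq _ | A : {set 'I_N} in _]).
have av v : aval x (avar R v) = x v by exact: aval_avar.
have P := pattern_constraintsP (fun i => av (inl i)) (fun a => av (inr a)).
have B := box_constraintsP (fun i => av (inl i)).
split.
  case/and4P => p /all_imageP h /all_imageP c b.
  split; [exact: (iffLR P p)| | |exact: (iffLR B b)].
    by move=> i; have := h i isT; rewrite /= aval0 av.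
  by move=> S SF; apply: c; rewrite powersetE.
case=> p h c b; apply/and4P.
split; [exact: (iffRL P p)|apply/all_imageP|apply/all_imageP|exact: (iffRL B b)].
  by move=> i _; rewrite /= aval0 av.
by move=> S; rewrite powersetE; exact: c.
Qed.

Lemma conv_hull_sub (V : lmodType R) (A C : set V) :
  convex_set C -> A `<=` C -> conv_hull A `<=` C.
Proof. exact: smallest_sub. Qed.

(** All the weight goes to the pattern that v itself shows on the fractional
    components. *)
Lemma Kset_sub_ext v : K v -> exists2 x, feasible ext x & \row_i x (inl (inl i)) = v.
Proof.
move=> Kv; have v01 : forall i, v 0 i = 0 \/ v 0 i = 1 by case: Kv.
have v0 i : 0 <= v 0 i by case: (v01 i) => ->.
have v1 i : v 0 i <= 1 by case: (v01 i) => ->.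
pose a : pattern w := [ffun j => v 0 (val j) == 1].
have va j : v 0 (val j) = (a j)%:R.
  by rewrite ffunE; case: (v01 (val j)) => ->; rewrite ?eqxx // eq_sym oner_eq0.
have vk := iffLR (Kset_pattern v01 va) Kv.
have aT : a \in T.
  by rewrite Tset_kcard -(ler_int R); apply: le_trans vk; exact: sumr_ge0.
pose a0 : adm := exist _ a aT.
have pick (c : adm -> R) : \sum_b (b == a0)%:R * c b = c a0.
  by rewrite (bigD1 a0) //= eqxx mul1r big1 ?addr0 // => b /negPf ->; rewrite mul0r.
exists (fun u => match u with
                 | inl (inl i) => v 0 i
                 | inl (inr b) => (b == a0)%:R
                 | inr (i, b) => (b == a0)%:R * v 0 (val i)
                 end); last by apply/rowP => i; rewrite mxE.
apply/ext_systemP; split; first split.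
- by have := pick (fun=> 1); under eq_bigr do rewrite mulr1.
- by move=> b; rewrite ler0n.
- move=> j; rewrite va; under eq_bigr do rewrite mulrC.
  by rewrite (pick (fun b : adm => (val b j)%:R)).
- split=> [i|b|i b]; first by rewrite (pick (fun=> v 0 (val i))).
    rewrite -mulr_sumr mulrC; case: eqP => [->|_]; last by rewrite !mulr0.
    by rewrite !mulr1 -(big_sub F (fun i => v 0 i)).
  by case: eqP => _; rewrite ?mul1r ?mul0r ?v0 ?v1 ?lexx.
- by move=> i _; rewrite v0 v1.
Qed.

(** Dividing by psi_a, a solution becomes the convex combination with weights psi_a
    of points u a that show the pattern a on J and satisfy its cardinality
    constraint on F; each of these is a combination of points of Kset by
    integrality of the capped cube. *)
Lemma conv_hull_ext :
  conv_hull K = [set \row_i x (inl (inl i)) | x in feasible ext].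
Proof.
rewrite eqEsubset; split.
  apply: conv_hull_sub; last exact: Kset_sub_ext.
  apply/convex_setE => _ _ t t01 [x xf <-] [y yf <-].
  exists (fun v => t * x v + (1 - t) * y v); first exact: feasible_convex.
  by apply/rowP => i; rewrite !mxE.
move=> _ [x /ext_systemP [[s1 p0 zj] [zf yk y01] zz] <-] M [Mc KM].
pose p a := x (inl (inr a)).
pose u (a : adm) : 'rV[R]_N := \row_i
  if (insub i : option {j | j \in J}) is Some j then (val a j)%:R
  else if (insub i : option (full w)) is Some i' then x (inr (i', a)) / p a
  else x (inl (inl i)).
have uJ a (j : {j | j \in J}) : u a 0 (val j) = (val a j)%:R by rewrite mxE valK.
have notJ (i : full w) : val i \notin J.
  by apply: contraTN (valP i) => /Jset_notF.
have uF a (i : full w) : u a 0 (val i) = x (inr (i, a)) / p a.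
  by rewrite mxE insubN ?valK.
have uZ a i : i \in Z -> u a 0 i = x (inl (inl i)).
  by move=> iZ; rewrite mxE !insubN ?Zset_notF ?Zset_notJ.
have -> : \row_i x (inl (inl i)) = \sum_a p a *: u a.
  apply/rowP => i; rewrite mxE summxE.
  under eq_bigr do rewrite mxE.
  have [iF|iJ|iZ] := FJZ_cases i.
  - rewrite -[i]/(val (exist (fun i => i \in F) i iF)) zf.
    apply: eq_bigr => a _; rewrite uF.
    have [pa0|pa] := eqVneq (p a) 0; last by rewrite mulrC divfK.
    (* If psi_a = 0 then y_i^a = 0, so the value of the quotient is immaterial. *)
    rewrite pa0 mul0r; apply: le_anti.
    by have := y01 (exist (fun i => i \in F) i iF) a; rewrite -/(p a) pa0 andbC.
  - rewrite -[i]/(val (exist (fun i => i \in J) i iJ)) zj.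
    by apply: eq_bigr => a _; rewrite uJ mulrC.
  - under eq_bigr do rewrite uZ //.
    by rewrite -mulr_suml s1 mul1r.
apply: convex_combination => // a pa.
apply: (@capped_cube_hull R N M F (kc (val a))) => //.
- move=> v v01 vu vk; apply: KM; apply: (iffRL (Kset_pattern v01 _)); last exact: vk.
  move=> j; rewrite vu; first exact: uJ.
  by rewrite inE (uJ a j); case: (val a j); rewrite ltxx ?andbF.
- move=> i; have [iF|iJ|iZ] := FJZ_cases i; last by rewrite uZ // zz.
    rewrite -[i]/(val (exist (fun i => i \in F) i iF)) uF.
    have /andP[h1 h2] := y01 (exist _ i iF) a.
    by rewrite divr_ge0 ?ler_pdivrMr ?mul1r // ltW.
  rewrite -[i]/(val (exist (fun i => i \in J) i iJ)) uJ.
  by case: (val a _); rewrite lexx ler01.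
- rewrite (big_sub F (fun i => u a 0 i)); under eq_bigr do rewrite uF.
  by rewrite -mulr_suml ler_pdivrMr // yk.
Qed.

Lemma Fset_imset (S : {set 'I_N}) : S \subset F ->
  exists S' : {set full w}, S = [set val i | i in S']%SET.
Proof.
move=> /fintype.subsetP SF; exists [set i | val i \in S]%SET.
apply/finset.setP => i; apply/idP/imsetP => [iS|[j]]; last by rewrite inE => jS ->.
by exists (exist _ i (SF _ iS)); rewrite // inE.
Qed.

Lemma sum_cut_full (f : 'I_N -> R) (S : {set full w}) :
  \sum_(i in [set val i | i in S]%SET) f i = \sum_(i in S) f (val i).
Proof. by apply: big_imset => i j _ _; exact: val_inj. Qed.

(** The cuts bound the sum of y^a over S in the two obvious ways; conversely they
    are exactly the condition under which the transportation problem for y is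
    solvable. *)
Lemma projection_ext_red :
  [set (fun v => x (inl v)) | x in feasible ext] = feasible red.
Proof.
rewrite eqEsubset; split.
  move=> _ [x /ext_systemP [[s1 p0 zj] [zf yk y01] zz] <-].
  apply/red_systemP; split => //.
    move=> i; have [iF|iJ|/zz/andP[]//] := FJZ_cases i.
      rewrite -[i]/(val (exist (fun i => i \in F) i iF)) zf.
      by apply: sumr_ge0 => a _; case/andP: (y01 (exist _ i iF) a).
    rewrite -[i]/(val (exist (fun i => i \in J) i iJ)) zj.
    by apply: sumr_ge0 => a _; rewrite mulr_ge0.
  move=> _ /Fset_imset [S ->]; rewrite holds_red_cut sum_cut_full (card_imset _ val_inj).
  under eq_bigr do rewrite zf.
  rewrite exchange_big /=; apply: ler_sum => a _.
  case: (leP #|S|%:R) => _.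
    rewrite mulr_natl -sumr_const; apply: ler_sum => i _.
    by case/andP: (y01 i a).
  apply: le_trans (yk a); rewrite [leRHS](bigID (mem S)) /= lerDl.
  by apply: sumr_ge0 => i _; case/andP: (y01 i a).
move=> x /red_systemP [[s1 p0 zj] z0 cuts zz].
have [|||y [y01 yk zy]] :=
    @transport R (full w) adm (fun i => x (inl (val i))) (fun a => x (inr a))
      (fun a => (kc (val a))%:~R) p0.
- by move=> a; rewrite ler0z -Tset_kcard (valP a).
- by move=> i; exact: z0.
- move=> S; have := cuts [set val i | i in S]%SET.
  rewrite holds_red_cut sum_cut_full (card_imset _ val_inj) => h.
  apply: le_trans (h _) _; last by apply: ler_sum => a _; rewrite mulrC.
  by apply/fintype.subsetP => _ /imsetP[i _ ->]; exact: valP.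
exists (fun u => match u with inl u => x u | inr (i, a) => y i a end) => //.
exact/ext_systemP.
Qed.

Lemma card_adm : (#|J| <= 2)%N -> (#|{: adm}| <= 4)%N.
Proof.
move=> J2; rewrite card_sig; apply: leq_trans (max_card _) _.
rewrite card_ffun card_bool card_sig -[4%N]/(2 ^ 2)%N leq_exp2l //.
Qed.

Lemma size_bounds : (0 < N)%N -> (#|J| <= 2)%N ->
  (#|{: extvar kin kout theta risk w}| <= 22 * N)%N /\ (size ext <= 22 * N)%N.
Proof.
move=> N0 J2; have A4 := card_adm J2.
have cN (S : {set 'I_N}) : (#|S| <= N)%N by rewrite -[leqRHS]card_ord max_card.
have cF : #|{: full w}| = #|F| by rewrite card_sig; apply: eq_card => i; rewrite inE.
have cJ : #|{: {j | j \in J}}| = #|J| by rewrite card_sig; apply: eq_card => i; rewrite inE.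
have FN := cN F; have ZN := cN Z; have FA := leq_mul FN A4.
split.
  rewrite !card_sum card_prod card_ord cF.
  apply: (@leq_trans (N + 4 + N * 4)%N); last lia.
  exact: leq_add (leq_add (leqnn _) A4) FA.
have size_pattern (V : finType) (z : 'I_N -> affine R V) (psi : adm -> affine R V) :
    size (pattern_constraints z psi) = (1 + (#|{: adm}| + #|J|))%N.
  rewrite /pattern_constraints size_cat; congr (_ + _)%N.
  rewrite size_cat; congr (_ + _)%N; first exact: size_image.
  by rewrite -cJ; exact: size_image.
have size_y (V : finType) (z : 'I_N -> affine R V) (psi : adm -> affine R V)
    (y : full w -> adm -> affine R V) : size (y_constraints z psi y) =
    (#|F| + (#|{: adm}| + (#|F| * #|{: adm}| + #|F| * #|{: adm}|)))%N.
  rewrite /y_constraints size_cat; congr (_ + _)%N.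
    by rewrite -cF; exact: size_image.
  rewrite size_cat; congr (_ + _)%N; first exact: size_image.
  by rewrite size_cat !size_allpairs -!cardE cF.
have size_box (V : finType) (z : 'I_N -> affine R V) :
    size (box_constraints w z) = (#|Z| + #|Z|)%N.
  by rewrite /box_constraints size_cat; congr (_ + _)%N; exact: size_image.
rewrite /ext_system; cbv zeta.
rewrite (size_cat (pattern_constraints _ _)) (size_cat (y_constraints _ _ _)).
rewrite size_pattern size_y size_box.
move: A4 FA; move: #|{: adm}| => A A4 FA; lia.
Qed.

Lemma red_cut0 x : holds x (red_cut kin kout theta risk w finset.set0).
Proof.
rewrite holds_red_cut big_set0 cards0 big1 // => a _.
by rewrite min_l ?mul0r // ler0z -Tset_kcard (valP a).
Qed.

(** The right-hand side of a cut depends only on the cardinality of the set, and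
    among the sets of a given cardinality a top set has the largest left-hand
    side. *)
Lemma separateP x :
  if separate x is Some A
  then A \subset F /\ ~~ holds x (red_cut kin kout theta risk w A)
  else forall S : {set 'I_N}, S \subset F -> holds x (red_cut kin kout theta risk w S).
Proof.
rewrite /separate; set L := [seq _ | m <- _].
have LE : L = [seq top_set (fun i => x (inl i)) F m | m <- iota 1 #|F|] by [].
case E: (seq.filter _ L) => [|A s]; last first.
  have : A \in seq.filter (fun A => ~~ holds x (red_cut kin kout theta risk w A)) L.
    by rewrite E mem_head.
  by rewrite mem_filter LE => /andP[Ax /mapP[m _ eA]]; split => //; rewrite eA top_set_sub.
move=> S SF; have [->|S0] := eqVneq S finset.set0; first exact: red_cut0.
pose m := #|S|; have mF : (m <= #|F|)%N by exact: subset_leq_card.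
have : holds x (red_cut kin kout theta risk w (top_set (fun i => x (inl i)) F m)).
  apply: contraT => nh.
  have : top_set (fun i => x (inl i)) F m \in
      seq.filter (fun A => ~~ holds x (red_cut kin kout theta risk w A)) L.
    rewrite mem_filter nh LE map_f // mem_iota add1n ltnS mF andbT.
    by rewrite card_gt0.
  by rewrite E.
rewrite !holds_red_cut card_top_set // => h; apply: le_trans h.
apply: ler_sum_top; first by rewrite card_top_set.
move=> i j iT jS jT; apply: top_setP iT _ jT; exact: (fintype.subsetP SF).
Qed.

End Reformulation.

Theorem theorem8 :
  exists C : nat,
  forall (R : realType) (X Y : polishMetricType R) (N : nat)
    (xhat : 'I_N -> X) (yhat : 'I_N -> Y) (x0 : X) (U : set X)
    (eps risk theta : R),
  (0 < N)%N ->
  nbhs x0 U ->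
  measurable (U : set (borel X)) ->
  (forall i, dist_to (xhat i) U \is a fin_num) ->
  (forall i, dist_to (xhat i) (~` U) \is a fin_num) ->
  0 < eps <= 1 ->
  0 < risk < 1 ->
  (theta_min xhat yhat U eps < theta%:E)%E ->
  let kin := fun i => fine (dist_to (xhat i) U) in
  let kout := fun i => fine (dist_to (xhat i) (~` U)) in
  (forall w : 'rV[R]_N, vertex (Wset kin kout theta eps) w ->
     (#|fractional w| <= 2)%N) /\
  (forall w : 'rV[R]_N, Wset kin kout theta eps w -> (#|Jset w| <= 2)%N ->
     [/\ conv_hull (Kset kin kout theta risk w) =
           [set \row_i x (inl (inl i))
             | x in feasible (ext_system kin kout theta risk w)],
         [/\ (#|{: adm kin kout theta risk w}| <= 4)%N,
             (#|{: extvar kin kout theta risk w}| <= C * N)%N &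
             (size (ext_system kin kout theta risk w) <= C * N)%N],
         [set (fun v => x (inl v))
           | x in feasible (ext_system kin kout theta risk w)] =
           feasible (red_system kin kout theta risk w),
         conv_hull (Kset kin kout theta risk w) =
           [set \row_i x (inl i)
             | x in feasible (red_system kin kout theta risk w)] &
         forall x : redvar kin kout theta risk w -> R,
           if separate x is Some A
           then A \subset Fset w /\ ~~ holds x (red_cut kin kout theta risk w A)
           else forall S : {set 'I_N}, S \subset Fset w ->
             holds x (red_cut kin kout theta risk w S)]).
Proof.
exists 22%N => R X Y N xhat yhat _ U eps risk theta N0 _ _ _ _ _ _ _ kin kout.
split=> [w|w [w01 _] J2]; first exact: vertex_fractional.
have NR : 0 < N%:R :> R by rewrite ltr0n.
have om01 i : 0 <= omega w i <= 1.
  have /andP[h0 h1] := w01 i; apply/andP; split; first by rewrite mulr_ge0 // ltW.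
  by rewrite /omega mulrC -ler_pdivlMr // div1r.
have [card_ext size_ext] := size_bounds kin kout theta risk N0 J2.
split => //.
- exact: conv_hull_ext.
- by split => //; exact: card_adm.
- exact: projection_ext_red.
- rewrite conv_hull_ext // -projection_ext_red // eqEsubset; split.
    by move=> _ [x xf <-]; exists (fun v => x (inl v)) => //; exists x.
  by move=> _ [_ [x xf <-] <-]; exists x.
- by move=> x; exact: separateP.
Qed.
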